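(* Let $K\subseteq\mathbf{R}^n$ be a nonempty unbounded closed set and let $f=(f_1,\dots,f_q):\mathbf{R}^n\to\mathbf{R}^q$ be a vector polynomial with $\deg f_i=d_i\ge1$, $\mathbf d=(d_1,\dots,d_q)$. Suppose that for every $\bar x\in K$ and every nonempty closed set $S\subseteq\mathbf{R}^n$ with $(K_{\bar x})_\infty\subseteq S_\infty\subseteq K_\infty$ the following two conditions hold: (i) the set $SOL^{w}(S_\infty,f^\infty_{\mathbf d})$ is unbounded (that is, $f$ is relatively strongly non-regular on $K$); (ii) for every $v\in SOL^{w}(S_\infty,f^\infty_{\mathbf d})\setminus\{0\}$ there exists $t>0$ such that $x-tv\in K$ and $f(x-tv)\le f(x)$ for all $x\in S$. Then $SOL^{s}(K,f)$ is nonempty.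
   Context: $\mathbf{R}^q_+$ is the nonnegative orthant; $y\le z$ in $\mathbf{R}^q$ means $z-y\in\mathbf{R}^q_+$. $K_{\bar x}=\{x\in K: f(x)\le f(\bar x)\}$. The asymptotic cone of a nonempty set $S$ is $S_\infty=\{v:\exists\, t_k\to+\infty,\ x_k\in S \text{ with } x_k/t_k\to v\}$. For a polynomial $p$ of degree $d$, $p^\infty_d(x)=\lim_{t\to+\infty}p(tx)/t^d$, and $f^\infty_{\mathbf d}=((f_1)^\infty_{d_1},\dots,(f_q)^\infty_{d_q})$. $SOL^{s}(A,g)=\{x^*\in A: g(x)-g(x^* )\notin-\mathbf{R}^q_+\setminus\{0\}\ \forall x\in A\}$ (Pareto efficient solutions), $SOL^{w}(A,g)=\{x^*\in A: g(x)-g(x^* )\notin-\operatorname{int}\mathbf{R}^q_+\ \forall x\in A\}$ (weak Pareto efficient solutions). *)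

(* Defs.v *)
From HB Require Import structures.
From mathcomp Require Import all_boot all_order all_algebra.
From mathcomp Require Import all_classical all_reals all_analysis.
(* The notations of mpoly clash with those of MathComp-Analysis, so only the
   structure instances are imported and names are qualified. *)
From mathcomp Require mpoly.
Import (canonicals, coercions) mpoly.

Set Implicit Arguments.
Unset Strict Implicit.
Unset Printing Implicit Defensive.

Import Order.TTheory GRing.Theory Num.Theory numFieldNormedType.Exports.

Local Open Scope classical_set_scope.
Local Open Scope ring_scope.

Definition nonneg_orthant (R : realType) (q : nat) : set 'rV[R]_q :=
  [set y | forall i : 'I_q, 0 <= y ord0 i].

Definition vle (R : realType) (q : nat) (y z : 'rV[R]_q) : Prop :=
  nonneg_orthant (z - y).

Definition sublevel (R : realType) (n q : nat)
    (K : set 'rV[R]_n) (g : 'rV[R]_n -> 'rV[R]_q) (xbar : 'rV[R]_n) :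
    set 'rV[R]_n :=
  [set x | K x /\ vle (g x) (g xbar)].

Definition asymptotic_cone (R : realType) (n : nat) (S : set 'rV[R]_n) :
    set 'rV[R]_n :=
  [set v | exists (t : nat -> R) (x : nat -> 'rV[R]_n),
    [/\ t k @[k --> \oo] --> +oo,
        (forall k, S (x k)) &
        (t k)^-1 *: x k @[k --> \oo] --> v]].

Definition peval (R : realType) (n : nat) (p : mpoly.mpoly n R)
    (x : 'rV[R]_n) : R :=
  mpoly.meval (fun j => x ord0 j) p.

(* [msize p] is the total degree plus one, and 0 for p = 0. *)
Definition has_degree (R : realType) (n : nat) (p : mpoly.mpoly n R)
    (d : nat) : Prop :=
  mpoly.msize p = d.+1.

Definition vpeval (R : realType) (n q : nat) (f : 'I_q -> mpoly.mpoly n R)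
    (x : 'rV[R]_n) : 'rV[R]_q :=
  \row_i peval (f i) x.

(* When p has degree d this limit exists and equals the degree-d homogeneous
   component of p; otherwise [lim] may be a default value. *)
Definition recession_poly (R : realType) (n : nat) (p : mpoly.mpoly n R)
    (d : nat) (x : 'rV[R]_n) : R :=
  lim (peval p (t *: x) / t ^+ d @[t --> +oo]).

Definition vrecession_poly (R : realType) (n q : nat)
    (f : 'I_q -> mpoly.mpoly n R) (d : 'I_q -> nat) (x : 'rV[R]_n) :
    'rV[R]_q :=
  \row_i recession_poly (f i) (d i) x.

Definition SOLs (R : realType) (n q : nat) (A : set 'rV[R]_n)
    (g : 'rV[R]_n -> 'rV[R]_q) : set 'rV[R]_n :=
  [set xs | A xs /\ forall x, A x ->
    ~ ([set - y | y in @nonneg_orthant R q] `\ 0) (g x - g xs)].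

Definition SOLw (R : realType) (n q : nat) (A : set 'rV[R]_n)
    (g : 'rV[R]_n -> 'rV[R]_q) : set 'rV[R]_n :=
  [set xs | A xs /\ forall x, A x ->
    ~ [set - y | y in interior (@nonneg_orthant R q)] (g x - g xs)].

(* Main.v *)
Require Import Defs.
From HB Require Import structures.
From mathcomp Require Import all_boot all_order all_algebra.
From mathcomp Require Import all_classical all_reals all_analysis.
From mathcomp Require Import lra.
From mathcomp Require mpoly.
Import (canonicals, coercions) mpoly.

Set Implicit Arguments.
Unset Strict Implicit.
Unset Printing Implicit Defensive.

Import Order.TTheory GRing.Theory Num.Theory numFieldNormedType.Exports.

Local Open Scope classical_set_scope.
Local Open Scope ring_scope.

(** Fix [xbar] in [K], put [S := sublevel K f xbar], let [C] be the asymptotic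
    cone of [S] and write [g] for the recession map of [f].

    A point of [K] minimising the sum of the [f i] over [S] is efficient on [K]
    ([sum_min_SOLs]), so it suffices that this sum attains its minimum on [S].
    If every nonzero direction [v] of [C] is a descent direction, i.e. one step
    along [- v], of a length common to all points of [S], stays in [S] and does
    not increase the sum, then the minimum is attained
    ([descent_attains_min]): were the points of least norm in their sublevel
    sets unbounded, they would escape in some direction [v] of [C], and a step
    along [- v] would shorten those far away without increasing the sum.
    Condition (ii) for the set [S] makes [v] a descent direction as soon as [v]
    is a weakly efficient solution for [g] on [C].

    It remains to see that every [v] in [C] is weakly efficient.  On the one
    hand [g v <= 0], because [f] is bounded above along [S] and all degrees are
    positive ([recession_poly_le0]).  On the other hand both conditions apply to
    the closed cone [C] itself, which is its own asymptotic cone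
    ([asymptotic_cone_idem]).  Condition (i) gives a nonzero weakly efficient
    [w] in [C].  The ray through [w] lies in [C], so condition (ii) says that
    [f] does not decrease along the points [0, t w, 2 t w, 3 t w, ...]; hence
    [0 <= g w] ([recession_poly_ge0]).  So [g v <= 0 <= g w], and lying below
    the value of a weakly efficient point forces [v] to be weakly efficient too
    ([SOLw_le]). *)

(** * Recession polynomials by homogenization *)

(** For [p] of degree at most [d], setting [s = 1] gives [p] back, and [s = 0]
    its part homogeneous of degree [d].  Treating [s] as a variable turns every limit of
    [p (x) / t ^ d] with [t] going to infinity into continuity at [s = 0]. *)
Definition homogenize (R : realType) (n : nat) (p : mpoly.mpoly n R) (d : nat)
    (s : R) (x : 'rV[R]_n) : R :=
  \sum_(m <- mpoly.msupp p)
    mpoly.mcoeff m p * s ^+ (d - mpoly.mdeg m) * \prod_i x ord0 i ^+ m i.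

Lemma peval_homogenize (R : realType) (n : nat) (p : mpoly.mpoly n R) (d : nat)
    (t : R) (x : 'rV[R]_n) :
  (mpoly.msize p <= d.+1)%N -> t != 0 ->
  peval p x / t ^+ d = homogenize p d t^-1 (t^-1 *: x).
Proof.
move=> pd t0; rewrite /peval mpoly.mevalE /homogenize mulr_suml.
rewrite !big_seq; apply: eq_bigr => m mp.
have md : (mpoly.mdeg m <= d)%N.
  by rewrite -ltnS; apply: leq_trans pd; exact: mpoly.msize_mdeg_lt.
under [X in _ = _ * X]eq_bigr do rewrite mxE exprMn.
rewrite big_split /= prodrXr -mpoly.mdegE.
rewrite !mulrA -[X in _ = X * _]mulrA -exprD subnK// exprVn.
by rewrite mulrAC.
Qed.

Lemma cvg_exprn (R : realType) (T : Type) (F : set_system T) {FF : Filter F}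
    (u : T -> R) (a : R) (k : nat) :
  u @ F --> a -> u t ^+ k @[t --> F] --> a ^+ k.
Proof.
move=> ua; elim: k => [|k IHk]; first by rewrite expr0; exact: cvg_cst.
by rewrite exprS; under eq_fun do rewrite exprS; exact: cvgM.
Qed.

Lemma cvg_homogenize (R : realType) (n : nat) (p : mpoly.mpoly n R) (d : nat)
    (T : Type) (F : set_system T) {FF : Filter F}
    (s : T -> R) (x : T -> 'rV[R]_n) (a : R) (v : 'rV[R]_n) :
  s @ F --> a -> x @ F --> v ->
  homogenize p d (s t) (x t) @[t --> F] --> homogenize p d a v.
Proof.
move=> sa xv; rewrite /homogenize.
apply: cvg_big => [|m _]; first exact: add_continuous.
apply: cvgM; first by apply: cvgM; [exact: cvg_cst|exact: cvg_exprn].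
apply: cvg_big => [|i _]; first exact: mul_continuous.
apply: cvg_exprn; apply: (cvg_comp x (fun y : 'rV[R]_n => y ord0 i) xv).
exact: coord_continuous.
Qed.

Lemma peval_continuous (R : realType) (n : nat) (p : mpoly.mpoly n R) :
  continuous (@peval R n p).
Proof.
have -> : peval p = homogenize p (mpoly.msize p) 1.
  apply/funext => x.
  have := peval_homogenize x (leqnSn (mpoly.msize p)) (oner_neq0 R).
  by rewrite expr1n invr1 mulr1 scale1r.
move=> v.
apply: (@cvg_homogenize _ _ _ _ _ (nbhs v) _ (fun=> 1) id).
  exact: cvg_cst.
exact: cvg_id.
Qed.

Lemma cvgy_inv0 (R : realType) (T : Type) (F : set_system T) {FF : Filter F}
    (t : T -> R) : t @ F --> +oo -> (t k)^-1 @[k --> F] --> 0.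
Proof. by move=> ty; apply/gtr0_cvgV0 => //; exact: cvgry_gt. Qed.

Lemma recession_polyE (R : realType) (n : nat) (p : mpoly.mpoly n R) (d : nat)
    (v : 'rV[R]_n) :
  (mpoly.msize p <= d.+1)%N -> recession_poly p d v = homogenize p d 0 v.
Proof.
move=> pd; apply: cvg_lim => //.
have h : homogenize p d t^-1 v @[t --> +oo] --> homogenize p d 0 v.
  by apply: cvg_homogenize; [exact: cvgy_inv0 cvg_id|exact: cvg_cst].
apply: cvg_trans h; apply: near_eq_cvg; near=> t.
have t0 : t != 0 by rewrite gt_eqF//; near: t; exact: nbhs_pinfty_gt.
by rewrite peval_homogenize// scalerA mulVf// scale1r.
Unshelve. all: by end_near. Qed.

(** Unlike in the definition of [recession_poly], the direction may vary with
    [t] here, as it does along a sequence that defines an asymptotic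
    direction. *)
Lemma cvg_recession (R : realType) (n : nat) (p : mpoly.mpoly n R) (d : nat)
    (t : nat -> R) (x : nat -> 'rV[R]_n) (v : 'rV[R]_n) :
  (mpoly.msize p <= d.+1)%N -> t k @[k --> \oo] --> +oo ->
  (t k)^-1 *: x k @[k --> \oo] --> v ->
  peval p (x k) / t k ^+ d @[k --> \oo] --> recession_poly p d v.
Proof.
move=> pd ty xv; rewrite recession_polyE//.
have h : homogenize p d (t k)^-1 ((t k)^-1 *: x k) @[k --> \oo] -->
    homogenize p d 0 v.
  by apply: cvg_homogenize => //; exact: cvgy_inv0.
apply: cvg_trans h; apply: near_eq_cvg; near=> k.
rewrite peval_homogenize// gt_eqF//.
by near: k; exact: cvgry_gt.
Unshelve. all: by end_near. Qed.

Lemma cvg_cst_div_expr (R : realType) (t : nat -> R) (d : nat) (c : R) :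
  (1 <= d)%N -> t k @[k --> \oo] --> +oo -> c / t k ^+ d @[k --> \oo] --> 0.
Proof.
move=> d1 ty; rewrite -[0](mulr0 c); apply: cvgM; first exact: cvg_cst.
have -> : (0 : R) = 0 ^+ d by rewrite expr0n; case: d d1.
under eq_fun do rewrite -exprVn.
by apply: cvg_exprn; exact: cvgy_inv0.
Qed.

(** Dividing the bound [p (x k) <= c] by [t k ^ d] kills [c], as [d] is
    positive. *)
Lemma recession_poly_le0 (R : realType) (n : nat) (p : mpoly.mpoly n R)
    (d : nat) (S : set 'rV[R]_n) (c : R) (v : 'rV[R]_n) :
  (1 <= d)%N -> (mpoly.msize p <= d.+1)%N ->
  (forall x, S x -> peval p x <= c) -> asymptotic_cone S v ->
  recession_poly p d v <= 0.
Proof.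
move=> d1 pd Sc [t [x [ty Sx xv]]].
apply: ler_cvg_to (cvg_recession pd ty xv) (cvg_cst_div_expr c d1 ty) _.
near=> k; rewrite ler_wpM2r ?Sc// invr_ge0 exprn_ge0//.
by near: k; exact: cvgry_ge.
Unshelve. all: by end_near. Qed.

(** By induction [p 0 <= p (k t w)] for all [k]; divide by [(k t) ^ d].  Only
    points [s w] with [s] positive are used, so that the hypothesis can be
    checked on any set stable under positive scaling. *)
Lemma recession_poly_ge0 (R : realType) (n : nat) (p : mpoly.mpoly n R)
    (d : nat) (w : 'rV[R]_n) (t : R) :
  (1 <= d)%N -> (mpoly.msize p <= d.+1)%N -> 0 < t ->
  (forall s, 0 < s -> peval p (s *: w - t *: w) <= peval p (s *: w)) ->
  0 <= recession_poly p d w.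
Proof.
move=> d1 pd t0 wt.
have p0 k : peval p 0 <= peval p ((t * k%:R) *: w).
  elim: k => [|k IHk]; first by rewrite mulr0 scale0r.
  have := wt (t * k.+1%:R); rewrite mulr_gt0// => /(_ isT).
  rewrite -scalerBl -natr1 mulrDr mulr1 addrK.
  exact: le_trans IHk.
have ty : t * k%:R @[k --> \oo] --> +oo.
  exact: cvg_comp cvgr_idn (gt0_cvgMry t0 cvg_id).
have xv : (t * k%:R)^-1 *: ((t * k%:R) *: w) @[k --> \oo] --> w.
  have h : cst w @ \oo --> w by exact: cvg_cst.
  apply: cvg_trans h; apply: near_eq_cvg; near=> k.
  rewrite scalerA mulVf ?scale1r// gt_eqF// mulr_gt0// ltr0n.
  by near: k; exact: nbhs_infty_gt.
apply: ler_cvg_to (cvg_cst_div_expr (peval p 0) d1 ty)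
  (cvg_recession pd ty xv) _.
by near=> k; rewrite ler_wpM2r// invr_ge0 exprn_ge0// mulr_ge0// ltW.
Unshelve. all: by end_near. Qed.

(** * Asymptotic cones *)

(** This form without sequences spares the extraction of diagonal sequences in
    the proofs below. *)
Lemma asymptotic_coneP (R : realType) (n : nat) (S : set 'rV[R]_n)
    (v : 'rV[R]_n) :
  asymptotic_cone S v <-> forall e M : R, 0 < e ->
    exists t x, [/\ M < t, S x & `|t^-1 *: x - v| < e].
Proof.
split=> [[t [x [ty Sx xv]]] e M e0|Sv].
  have [k [Mt xe]] : exists k, M < t k /\ `|(t k)^-1 *: x k - v| < e.
    apply: (@filter_ex _ (\oo : set_system nat)); near=> k; split.
      by near: k; exact: cvgry_gt.
    by near: k; move/cvgrPdistC_lt: xv; exact.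
  by exists (t k), (x k).
have /choice[tx txP] k : exists tx : R * 'rV[R]_n,
    [/\ k%:R < tx.1, S tx.2 & `|tx.1^-1 *: tx.2 - v| < k.+1%:R^-1].
  have [|t [x ?]] := Sv k.+1%:R^-1 k%:R; first by rewrite invr_gt0 ltr0n.
  by exists (t, x).
exists (fun k => (tx k).1), (fun k => (tx k).2); split.
- apply/cvgryPgt => A; near=> k; have [kt _ _] := txP k.
  by apply: lt_trans kt; near: k; exact: nbhs_infty_gtr.
- by move=> k; have [] := txP k.
- apply/cvgrPdistC_lt => e e0; near=> k; have [_ _ kv] := txP k.
  by apply: lt_trans kv _; near: k; exact: near_infty_natSinv_lt (PosNum e0).
Unshelve. all: by end_near. Qed.

Lemma asymptotic_cone_closed (R : realType) (n : nat) (S : set 'rV[R]_n) :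
  closed (asymptotic_cone S).
Proof.
move=> v /= clv; apply/asymptotic_coneP => e M e0.
have e2 : 0 < e / 2 by rewrite divr_gt0.
have [u [/asymptotic_coneP Su /= vu]] := clv _ (nbhsx_ballx v _ e2).
have [t [x [Mt Sx xu]]] := Su _ M e2.
exists t, x; split=> //; rewrite -(subrKA u) [e]splitr.
apply: le_lt_trans (ler_normD _ _) (ltrD xu _).
by rewrite distrC; move: vu; rewrite -ball_normE.
Qed.

Lemma asymptotic_coneZ (R : realType) (n : nat) (S : set 'rV[R]_n)
    (s : R) (v : 'rV[R]_n) :
  0 < s -> asymptotic_cone S v -> asymptotic_cone S (s *: v).
Proof.
move=> s0 [t [x [ty Sx xv]]]; exists (fun k => t k / s), x; split=> //.
  by apply: cvg_comp ty (gt0_cvgMly _ cvg_id); rewrite invr_gt0.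
under eq_fun do rewrite invf_div -scalerA.
by apply: cvgZ => //; exact: cvg_cst.
Qed.

Lemma asymptotic_cone_idem (R : realType) (n : nat) (S : set 'rV[R]_n) :
  asymptotic_cone (asymptotic_cone S) = asymptotic_cone S.
Proof.
apply/seteqP; split=> v.
  move=> /asymptotic_coneP SSv; apply: asymptotic_cone_closed => B.
  move=> /nbhs_ballP[e /= e0 eB]; have [t [x [t0 Sx xv]]] := SSv e 0 e0.
  exists (t^-1 *: x); split; first by apply: asymptotic_coneZ; rewrite ?invr_gt0.
  by apply: eB; rewrite -ball_normE /= distrC.
move=> Sv; apply/asymptotic_coneP => e M e0.
have t0 : 0 < `|M| + 1 by rewrite ltr_wpDl.
exists (`|M| + 1), ((`|M| + 1) *: v); split.
- by rewrite (le_lt_trans (ler_norm M))// ltrDl.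
- exact: asymptotic_coneZ.
- by rewrite scalerA mulVf ?gt_eqF// scale1r subrr normr0.
Qed.

Lemma asymptotic_cone0 (R : realType) (n : nat) (S : set 'rV[R]_n) :
  S !=set0 -> asymptotic_cone S 0.
Proof.
case=> x Sx; exists (fun k => k%:R), (fun=> x); split=> //.
  exact: cvgr_idn.
rewrite -[0](scale0r x).
by apply: cvgZ; [exact: cvgy_inv0 cvgr_idn|exact: cvg_cst].
Qed.

Lemma asymptotic_cone_sub (R : realType) (n : nat) (A B : set 'rV[R]_n) :
  A `<=` B -> asymptotic_cone A `<=` asymptotic_cone B.
Proof.
by move=> AB v [t [x [ty Ax xv]]]; exists t, x; split=> // k; exact: AB.
Qed.

(** Normalise points of [A] of norm tending to infinity, and take a cluster
    point on the unit sphere, which is compact. *)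
Lemma unbounded_asymptotic_dir (R : realType) (n : nat) (A : set 'rV[R]_n) :
  ~ bounded_set A -> exists2 v, asymptotic_cone A v & `|v| = 1.
Proof.
move=> nbA.
have /choice[z zP] (k : nat) : exists z, A z /\ k%:R < `|z|.
  apply/not_existsP => zk; apply: nbA; exists k%:R; split; first exact: num_real.
  move=> M kM z Az; apply: le_trans (ltW kM).
  by rewrite leNgt; apply/negP => kz; apply: (zk z).
pose u k := `|z k|^-1 *: z k.
have u1 k : `|u k| = 1.
  have [_ zk] := zP k; rewrite normrZ normfV normr_id mulVf// gt_eqF//.
  by apply: le_lt_trans zk.
have csph : compact [set x : 'rV[R]_n | `|x| = 1].
  apply: bounded_closed_compact.
    by exists 1; split; [exact: num_real|move=> M M1 x /= ->; exact: ltW].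
  apply: (@preimage_closed _ _ _ [set 1 : R]); last exact: closed_eq.
  by move=> x _; exact: norm_continuous.
have [|v [v1 uv]] := csph (u @ \oo); first by exists 0%N => // k _; exact: u1.
exists v => //; apply/asymptotic_coneP => e M e0.
have uM : (u @ \oo) (u @` [set k | M < k%:R]).
  have [N _ NM] := nbhs_infty_gtr M.
  by exists N => // k Nk; exists k => //; exact: NM.
have [_ [[k Mk <-] /=]] := uv _ _ uM (nbhsx_ballx v e e0).
rewrite -ball_normE /= distrC => vk.
by exists `|z k|, (z k); have [Az zk] := zP k; split=> //; exact: lt_trans zk.
Qed.

(** * Attainment of minima along descent directions *)

Lemma closed_preimage_le (R : realType) (n : nat) (g : 'rV[R]_n -> R) (c : R) :
  continuous g -> closed [set x | g x <= c].
Proof.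
move=> gcont; apply: (@preimage_closed _ _ _ [set y : R | y <= c]).
  by move=> x _; exact: gcont.
exact: closed_le.
Qed.

Lemma compact_setI_ball (R : realType) (n : nat) (S : set 'rV[R]_n) (M : R) :
  closed S -> compact (S `&` [set x | `|x| <= M]).
Proof.
move=> Scl; apply: bounded_closed_compact.
  exists M; split; first exact: num_real.
  by move=> M' MM' x [_ /= xM]; exact: le_trans (ltW MM').
by apply: closedI => //; apply: closed_preimage_le; exact: norm_continuous.
Qed.

Lemma norm_min (R : realType) (n : nat) (S : set 'rV[R]_n) :
  S !=set0 -> closed S -> exists2 z, S z & forall y, S y -> `|z| <= `|y|.
Proof.
move=> [x0 Sx0] Scl.
have [||z] := @EVT_min_rV R n (fun x => `|x|) _ _ (compact_setI_ball (M := `|x0|) Scl).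
- by exists x0; split=> /=.
- by apply: continuous_subspaceT; exact: norm_continuous.
rewrite inE => -[Sz zx0] zmin; exists z => // y Sy.
have [yx0|/ltW x0y] := leP `|y| `|x0|; last exact: le_trans x0y.
by apply: zmin; rewrite inE.
Qed.

(** A point [z] lying far away in direction [v] gets shorter by a step along
    [- v].  As [z - t v = (1 - t / s) z + t (z / s - v)], the step gains
    [t |z| / s], which is close to [t], and loses at most [t |z / s - v|]; with
    the tolerance [1 / 2] the gain stays above [t / 2] and the loss below.  This
    uses only the triangle inequality, so it holds for the sup norm, which is
    not strictly convex. *)
Lemma norm_sub_lt (R : realType) (n : nat) (v z : 'rV[R]_n) (s t : R) :
  0 < t -> t < s -> `|v| = 1 -> `|s^-1 *: z - v| < 2^-1 ->
  `|z - t *: v| < `|z|.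
Proof.
move=> t0 ts v1 zv; have s0 : 0 < s by exact: lt_trans ts.
have -> : z - t *: v = (1 - t / s) *: z + t *: (s^-1 *: z - v).
  by rewrite scalerBl scale1r scalerBr scalerA addrA subrK.
have zs : 1 - 2^-1 < `|z| / s.
  have -> : `|z| / s = `|s^-1 *: z| by rewrite normrZ normfV (gtr0_norm s0) mulrC.
  by rewrite ltrBlDr -{1}v1 -ltrBlDl (le_lt_trans _ zv)// distrC lerB_dist.
apply: le_lt_trans (ler_normD _ _) _.
rewrite !normrZ (gtr0_norm t0) ger0_norm; last first.
  by rewrite subr_ge0 ler_pdivrMr// mul1r ltW.
rewrite mulrBl mul1r -ltrBrDl opprB addrCA subrr addr0 -mulrA ltr_pM2l//.
rewrite mulrC; apply: lt_trans zv _; apply: le_lt_trans zs; lra.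
Qed.

(** The set [A] below consists of the points of least norm in their own
    sublevel set.  Every value of [g] on [S] is matched or beaten on [A], so
    once [A] is bounded, minimising [g] over a ball containing [A] minimises it
    over all of [S]; and an unbounded [A] would contain points that a descent
    step shortens. *)
Lemma descent_attains_min (R : realType) (n : nat) (S : set 'rV[R]_n)
    (g : 'rV[R]_n -> R) :
  S !=set0 -> closed S -> continuous g ->
  (forall v, asymptotic_cone S v -> v != 0 -> exists2 t, 0 < t &
    forall x, S x -> S (x - t *: v) /\ g (x - t *: v) <= g x) ->
  exists2 x, S x & forall y, S y -> g x <= g y.
Proof.
move=> S0 Scl gcont desc.
pose A := [set z | S z /\ forall y, S y -> g y <= g z -> `|z| <= `|y|].
have AS : A `<=` S by move=> z [].
have Acofinal y : S y -> exists2 z, A z & g z <= g y.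
  move=> Sy; pose L := S `&` [set z | g z <= g y].
  have [||z [Sz zy] zmin] := @norm_min R n L.
  - by exists y; split=> /=.
  - by apply: closedI => //; exact: closed_preimage_le.
  exists z => //; split=> // y' Sy' y'z; apply: zmin; split=> //=.
  exact: le_trans zy.
have [M AM] : exists M, forall z, A z -> `|z| <= M.
  have [bA|/unbounded_asymptotic_dir[v Av v1]] := pselect (bounded_set A).
    have [M M0 /= MA] := ex_strict_bound_gt0 bA.
    by exists M => z /MA /ltW.
  have [|t t0 tv] := desc v (asymptotic_cone_sub AS Av).
    by rewrite -normr_gt0 v1.
  have /asymptotic_coneP Av' := Av.
  have [|s [z [ts [Sz zmin] zv]]] := Av' 2^-1 t; first by rewrite invr_gt0.
  have [Sz' gz'] := tv z Sz; have := zmin _ Sz' gz'.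
  by rewrite leNgt (norm_sub_lt t0 ts v1 zv).
have [||x] := @EVT_min_rV R n g _ _ (compact_setI_ball (M := M) Scl).
- have [y /Acofinal[z Az _]] := S0.
  by exists z; split; [exact: AS|exact: AM].
- exact: continuous_subspaceT.
rewrite inE => -[Sx _] xmin; exists x => // y /Acofinal[z Az zy].
by apply: le_trans zy; apply: xmin; rewrite inE; split; [exact: AS|exact: AM].
Qed.

(** * Efficient and weakly efficient points *)

Lemma vle_vpevalP (R : realType) (n q : nat) (f : 'I_q -> mpoly.mpoly n R)
    (x y : 'rV[R]_n) :
  vle (vpeval f x) (vpeval f y) <-> forall i, peval (f i) x <= peval (f i) y.
Proof. by split=> xy i; have := xy i; rewrite !mxE subr_ge0. Qed.

Lemma vle_trans (R : realType) (q : nat) (y x z : 'rV[R]_q) :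
  vle x y -> vle y z -> vle x z.
Proof.
move=> xy yz i; have := xy i; have := yz i; rewrite !mxE; lra.
Qed.

Lemma sublevel_closed (R : realType) (n q : nat) (K : set 'rV[R]_n)
    (f : 'I_q -> mpoly.mpoly n R) (xbar : 'rV[R]_n) :
  closed K -> closed (sublevel K (vpeval f) xbar).
Proof.
move=> Kcl.
have -> : sublevel K (vpeval f) xbar = K `&`
    \bigcap_(i in [set: 'I_q]) [set x | peval (f i) x <= peval (f i) xbar].
  by apply/seteqP; split=> x [Kx] => [/vle_vpevalP|] fx; split=> //;
    [move=> i _; exact: fx|apply/vle_vpevalP => i; exact: fx].
apply: closedI => //; apply: closed_bigI => i _.
by apply: closed_preimage_le; exact: peval_continuous.
Qed.

Lemma interior_orthantD (R : realType) (q : nat) (y z : 'rV[R]_q) :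
  interior (@nonneg_orthant R q) y -> nonneg_orthant z ->
  interior (@nonneg_orthant R q) (y + z).
Proof.
move=> /nbhs_ballP[e /= e0 ye] z0; apply/nbhs_ballP; exists e => //= u yzu i.
have := ye (u - z); rewrite -ball_normE /= opprB addrCA addrC => /(_ _ i).
rewrite mxE => uz; move: yzu; rewrite -ball_normE /= => yzu.
have := addr_ge0 (uz _) (z0 i); rewrite !mxE subrK; apply.
by rewrite addrAC.
Qed.

(** Any point strictly better than [v] would be strictly better than [w],
    because adding a nonnegative vector to an interior point of the orthant
    stays in the interior. *)
Lemma SOLw_le (R : realType) (n q : nat) (A : set 'rV[R]_n)
    (g : 'rV[R]_n -> 'rV[R]_q) (w v : 'rV[R]_n) :
  SOLw A g w -> A v -> vle (g v) (g w) -> SOLw A g v.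
Proof.
move=> [_ wA] Av vw; split=> // x Ax [y y0 yE]; apply: (wA x Ax).
exists (y + (g w - g v)); first exact: interior_orthantD.
by rewrite opprD yE opprB subrKA.
Qed.

(** A point of [K] dominating [xs] is again in the sublevel set of [xbar], where
    its sum is at least that of [xs]; so the nonnegative difference vector has
    sum zero and vanishes. *)
Lemma sum_min_SOLs (R : realType) (n q : nat) (K : set 'rV[R]_n)
    (g : 'rV[R]_n -> 'rV[R]_q) (xbar xs : 'rV[R]_n) :
  sublevel K g xbar xs ->
  (forall x, sublevel K g xbar x -> \sum_i g xs ord0 i <= \sum_i g x ord0 i) ->
  SOLs K g xs.
Proof.
move=> [Kxs xsbar] xsmin; split=> // x Kx [[y y0 yE] yN0].
have xE : g x = g xs - y by rewrite yE addrC subrK.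
have : \sum_i g xs ord0 i <= \sum_i g x ord0 i.
  apply: xsmin; split=> //; apply: vle_trans xsbar.
  by rewrite /vle xE opprB addrC subrK.
under [leRHS]eq_bigr do rewrite xE !mxE.
rewrite big_split /= sumrN lerDl oppr_ge0 => ysum; apply: yN0; rewrite -yE.
suff -> : y = 0 by rewrite oppr0.
have /eqP : \sum_i y ord0 i = 0 by apply/le_anti; rewrite ysum sumr_ge0.
rewrite psumr_eq0// => /allP ally; apply/rowP => i; rewrite mxE.
by apply/eqP/ally; rewrite mem_index_enum.
Qed.

Lemma unbounded_neq0 (R : realType) (n : nat) (A : set 'rV[R]_n) :
  ~ bounded_set A -> exists w, (A `\ 0) w.
Proof.
move=> nbA; apply/not_existsP => A0; apply: nbA; exists 0.
split; first exact: num_real.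
move=> M M0 x Ax; have [->|x0] := eqVneq x 0; first by rewrite /= normr0 ltW.
by case: (A0 x); split=> //; exact/eqP.
Qed.

(** * Existence of an efficient solution *)

Theorem theorem13 (R : realType) (n q : nat)
    (K : set 'rV[R]_n) (f : 'I_q -> mpoly.mpoly n R) (d : 'I_q -> nat)
    (K_nonempty : K !=set0) (K_unbounded : ~ bounded_set K)
    (K_closed : closed K)
    (d_ge1 : forall i, (1 <= d i)%N)
    (deg_f : forall i, has_degree (f i) (d i))
    (H : forall (xbar : 'rV[R]_n) (S : set 'rV[R]_n),
      K xbar -> S !=set0 -> closed S ->
      asymptotic_cone (sublevel K (vpeval f) xbar) `<=` asymptotic_cone S ->
      asymptotic_cone S `<=` asymptotic_cone K ->
      ~ bounded_set (SOLw (asymptotic_cone S) (vrecession_poly f d)) /\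
      (forall v : 'rV[R]_n,
        (SOLw (asymptotic_cone S) (vrecession_poly f d) `\ 0) v ->
        exists2 t : R, 0 < t &
          forall x, S x ->
            K (x - t *: v) /\ vle (vpeval f (x - t *: v)) (vpeval f x))) :
  SOLs K (vpeval f) !=set0.
Proof.
have [xbar Kxbar] := K_nonempty.
pose S := sublevel K (vpeval f) xbar; pose C := asymptotic_cone S.
have S0 : S !=set0 by exists xbar; split=> //; apply/vle_vpevalP.
have Scl : closed S by exact: sublevel_closed.
have SK : C `<=` asymptotic_cone K by apply: asymptotic_cone_sub => x [].
have size_f i : (mpoly.msize (f i) <= (d i).+1)%N by rewrite deg_f.
have fle0 i v : C v -> recession_poly (f i) (d i) v <= 0.
  apply: (@recession_poly_le0 _ _ _ _ _ (peval (f i) xbar)) => // x [_].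
  by move/vle_vpevalP.
have [w [wC w_ge0]] : exists w, SOLw C (vrecession_poly f d) w /\
    forall i, 0 <= recession_poly (f i) (d i) w.
  (* Here the cone [C] is itself the test set of both conditions. *)
  have [||||] := H xbar C Kxbar; rewrite ?asymptotic_cone_idem//.
  - by exists 0; exact: asymptotic_cone0.
  - exact: asymptotic_cone_closed.
  move=> /unbounded_neq0[w wC0] /(_ w wC0)[t t0 wt].
  have [wC _] := wC0; exists w; split=> // i.
  apply: (recession_poly_ge0 (t := t)) => // s s0.
  have [|_ /vle_vpevalP //] := wt (s *: w).
  by apply: asymptotic_coneZ => //; case: wC.
have CSOL : C `<=` SOLw C (vrecession_poly f d).
  move=> v Cv; apply: (SOLw_le wC Cv) => i.
  by rewrite !mxE subr_ge0; exact: le_trans (fle0 i v Cv) (w_ge0 i).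
have [x Sx xmin] : exists2 x, S x & forall y, S y ->
    \sum_i vpeval f x ord0 i <= \sum_i vpeval f y ord0 i.
  apply: descent_attains_min => //.
    apply: continuous_big => [|i _]; first exact: add_continuous.
    by under eq_fun do rewrite mxE; exact: peval_continuous.
  have [_ desc] := H xbar S Kxbar S0 Scl (fun _ => id) SK.
  move=> v Cv /eqP v0; have [t t0 vt] := desc v (conj (CSOL v Cv) v0).
  exists t => // x Sx; have [Kx' fx'] := vt x Sx; split.
    by split=> //; apply: vle_trans fx' _; case: Sx.
  by apply: ler_sum => i _; move/vle_vpevalP: fx' => /(_ i); rewrite !mxE.
by exists x; exact: sum_min_SOLs Sx xmin.
Qed.
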